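(* Let $n\ge3$ and let $\mathcal{G}$ be the directed line graph on nodes $\{1,\dots,n\}$ with edges $(i,i+1)$ and $(i+1,i)$ for $i=1,\dots,n-1$ together with self-loops $(i,i)$ at every node, and let $\tau\in\mathbb{Z}$ with $n-1\le\tau\le 2n-3$. Suppose the problem of maximizing $\min_{i,j}\mathbb{P}(T_{ij}(P)\le\tau)$ over all Markov chain strategies $P$ conforming to $\mathcal{G}$ has a unique optimal solution. Then this optimal solution is the matrix $P^*$ with $P^*(1,2)=1$, $P^*(n,n-1)=1$, $P^*(i,i-1)=P^*(i,i+1)=\frac12$ for $i=2,\dots,n-1$, and all other entries $0$.
   Context: A Markov chain strategy conforming to $\mathcal{G}=(V,\mathcal{E})$ is a row-stochastic nonnegative $P=(p_{ij})$ with $p_{ij}=0$ for $(i,j)\notin\mathcal{E}$. For the Markov chain $(X_k)$ with transition matrix $P$, $T_{ij}=\min\{k\ge1:X_k=j\}$ given $X_0=i$. *)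

(* Defs.v *)
From HB Require Import structures.
From mathcomp Require Import all_boot all_order all_algebra.
From mathcomp Require Import reals.
Set Implicit Arguments. Unset Strict Implicit. Unset Printing Implicit Defensive.
Import Order.TTheory GRing.Theory Num.Theory.
Local Open Scope ring_scope.

(* Nodes {1..n} are represented 0-based as 'I_n. *)

Definition line_edge (n : nat) (i j : 'I_n) : bool :=
  (i == j) || (i.+1 == j :> nat) || (j.+1 == i :> nat).

Definition conforming (R : realType) (n : nat) (P : 'M[R]_n) : Prop :=
  (forall i j, 0 <= P i j) /\
  (forall i, \sum_(j < n) P i j = 1) /\
  (forall i j, ~~ line_edge i j -> P i j = 0).

(* P(T_ij = m) for m >= 1: total probability of the paths
   X_0 = i, X_1, ..., X_m = j with X_t <> j for 0 < t < m. *)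
Definition first_pass (R : realType) (n : nat) (P : 'M[R]_n) (i j : 'I_n)
    (m : nat) : R :=
  \sum_(x : {ffun 'I_m.+1 -> 'I_n} |
          [&& x ord0 == i, x ord_max == j &
              [forall t : 'I_m.+1, ((0 < t) && (t < m))%N ==> (x t != j)]])
    \prod_(t < m) P (x (inord t)) (x (inord t.+1)).

Definition hit_le (R : realType) (n : nat) (P : 'M[R]_n) (i j : 'I_n)
    (tau : nat) : R :=
  \sum_(1 <= m < tau.+1) first_pass P i j m.

(* Objective: min_{i,j} P(T_ij <= tau).  The identity 1 of the min-fold is
   harmless since all the values are probabilities (<= 1) and n >= 1. *)
Definition objective (R : realType) (n : nat) (P : 'M[R]_n) (tau : nat) : R :=
  \big[Num.min/1]_(i < n) \big[Num.min/1]_(j < n) hit_le P i j tau.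

Definition optimal (R : realType) (n : nat) (tau : nat) (P : 'M[R]_n) : Prop :=
  conforming P /\
  forall Q : 'M[R]_n, conforming Q -> objective Q tau <= objective P tau.

Definition Pstar (R : realType) (n : nat) : 'M[R]_n :=
  \matrix_(i < n, j < n)
    if (i == 0 :> nat) then (if (j == 1 :> nat) then 1 else 0)
    else if (i == n.-1 :> nat) then (if (j == n.-2 :> nat) then 1 else 0)
    else if (j.+1 == i :> nat) || (i.+1 == j :> nat) then 2^-1 else 0.

(* Main.v *)
(* The objective is the smaller of the two end-to-end hitting probabilities,
   since a walk on a line crossing from one end to the other passes through
   every node.  Two transformations of a strategy do not decrease it, so they fix
   the unique optimum: deleting the self-loops (which only saves time), and, for
   a strategy without self-loops, exchanging the left and right probabilities at
   every inner node.  The latter swaps the two end-to-end probabilities: the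
   increments h(i+1) - h(i-1) of the probabilities h(i) of reaching the right end
   within a given time evolve by the forward equation of the exchanged walk
   killed at the left end.  A fixed point of both is P^*. *)
Require Import Defs.
From HB Require Import structures.
From mathcomp Require Import all_boot all_order all_algebra.
From mathcomp Require Import reals.
From mathcomp Require Import zify ring lra.
Import Order.TTheory GRing.Theory Num.Theory.
Local Open Scope ring_scope.

(** * First-step equations for hitting probabilities *)

Definition path_cons {n m : nat} (i : 'I_n) (y : {ffun 'I_m.+1 -> 'I_n}) :
  {ffun 'I_m.+2 -> 'I_n} := [ffun t => oapp y i (unlift ord0 t)].

Definition path_behead {n m : nat} (x : {ffun 'I_m.+2 -> 'I_n}) :
  {ffun 'I_m.+1 -> 'I_n} := [ffun t => x (lift ord0 t)].

Lemma path_cons0 {n m} (i : 'I_n) (y : {ffun 'I_m.+1 -> 'I_n}) :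
  path_cons i y ord0 = i.
Proof. by rewrite ffunE unlift_none. Qed.

Lemma path_cons_lift {n m} (i : 'I_n) (y : {ffun 'I_m.+1 -> 'I_n}) t :
  path_cons i y (lift ord0 t) = y t.
Proof. by rewrite ffunE liftK. Qed.

Lemma inordS m t : (t <= m)%N -> inord t.+1 = lift ord0 (inord t : 'I_m.+1).
Proof. by move=> tm; apply: val_inj; rewrite /= !inordK. Qed.

Lemma first_pass1 (R : realType) n (P : 'M[R]_n) i j :
  first_pass P i j 1 = P i j.
Proof.
rewrite /first_pass (reindex_onto (fun k : 'I_n => path_cons i [ffun _ : 'I_1 => k])
  (fun x => x ord_max)) /=; last first.
  move=> x /and3P[/eqP xi _ _]; apply/ffunP=> t; case: (unliftP ord0 t) => [u ->|->].
    rewrite path_cons_lift ffunE; congr (x _); apply: val_inj => /=.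
    by case: u => -[|u].
  by rewrite path_cons0.
have maxE : ord_max = lift ord0 (ord0 : 'I_1) by apply: val_inj.
rewrite (big_pred1 j) => [|k] /=.
  rewrite big_ord1 inordS // path_cons_lift ffunE.
  have -> : inord 0 = ord0 :> 'I_2 by apply: val_inj; rewrite /= inordK.
  by rewrite unlift_none ffunE.
rewrite path_cons0 eqxx /= maxE path_cons_lift ffunE eqxx andbT.
rewrite andb_idr // => _; apply/forallP => t.
by apply/implyP; case: t => -[|[|t]].
Qed.

(** The first step is cut off: time 1 lies strictly before the hit, so the next node [k] must avoid
    [j], and what remains is a first-passage path from [k]. *)
Lemma first_passS (R : realType) n (P : 'M[R]_n) i j m :
  first_pass P i j m.+2 =
  \sum_(k | k != j) P i k * first_pass P k j m.+1.
Proof.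
have maxE : ord_max = lift ord0 (ord_max : 'I_m.+2) by apply: val_inj.
rewrite /first_pass (reindex_onto (path_cons i) path_behead) /=; last first.
  move=> x /and3P[/eqP xi _ _]; apply/ffunP=> t; case: (unliftP ord0 t) => [u ->|->].
    by rewrite path_cons_lift ffunE.
  by rewrite path_cons0.
under [RHS]eq_bigr => k _ do rewrite mulr_sumr.
(* For each tail [y] only [k = y ord0] contributes. *)
rewrite (exchange_big_dep xpredT) //= big_mkcond [RHS]big_mkcond /=.
apply: eq_bigr => y _; rewrite path_cons0 eqxx /= maxE path_cons_lift.
have -> : path_behead (path_cons i y) = y.
  by apply/ffunP => t; rewrite ffunE path_cons_lift.
rewrite eqxx andbT.
rewrite (eq_bigl (fun k => (k == y ord0) && [&& y ord0 != j, y ord_max == j &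
  [forall t : 'I_m.+2, ((0 < t) && (t < m.+1))%N ==> (y t != j)]])); last first.
  by move=> k /=; case: (k =P y ord0) => [->|/eqP]; rewrite ?eqxx // eq_sym =>
    /negPf -> /=; rewrite andbF.
have -> : [forall t : 'I_m.+3, ((0 < t) && (t < m.+2))%N ==> (path_cons i y t != j)] =
   (y ord0 != j) &&
   [forall t : 'I_m.+2, ((0 < t) && (t < m.+1))%N ==> (y t != j)].
  apply/forallP/andP => [H|[H0 /forallP H] t].
    split; first by have := H (lift ord0 ord0); rewrite path_cons_lift.
    apply/forallP => t; have := H (lift ord0 t); rewrite path_cons_lift /=.
    by rewrite /bump /= add1n ltnS; case: (0 < t)%N; rewrite //=.
  case: (unliftP ord0 t) => [u ->|->] //; rewrite path_cons_lift /= /bump /=.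
  rewrite add1n ltnS; have := H u; case: (posnP u) => [u0 _|u0] //=.
  by rewrite (_ : u = ord0) ?H0 ?implybT //; apply: val_inj.
rewrite andbCA; case: ifP => _; last by rewrite big_pred0 // => k; rewrite andbF.
rewrite (big_pred1 (y ord0)) => [|k]; last by rewrite andbT.
rewrite big_ord_recl /=; congr (_ * _).
  have -> : inord 0 = ord0 :> 'I_m.+3 by apply: val_inj; rewrite /= inordK.
  rewrite inordS // path_cons0 path_cons_lift; congr (P _ (y _)).
  by apply: val_inj; rewrite /= inordK.
apply: eq_bigr => t _; rewrite /bump /= add1n.
by rewrite !inordS ?path_cons_lift //; have := ltn_ord t; lia.
Qed.

(** Time 0 counts here, so the target has value 1 at once. This agrees with [hit_le] off the target;
    a return needs one explicit first step, as in [hit_leS]. *)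
Fixpoint hit_prob {R : realType} {n} (P : 'M[R]_n) (j : 'I_n) (t : nat)
    (i : 'I_n) : R :=
  if i == j then 1 else
  if t is t'.+1 then \sum_k P i k * hit_prob P j t' k else 0.

Lemma hit_prob_id {R : realType} {n} (P : 'M[R]_n) j t : hit_prob P j t j = 1.
Proof. by case: t => [|t] /=; rewrite eqxx. Qed.

Lemma hit_prob_neq {R : realType} {n} (P : 'M[R]_n) j t i : i != j ->
  hit_prob P j t.+1 i = \sum_k P i k * hit_prob P j t k.
Proof. by move=> /= /negPf ->. Qed.

Lemma hit_le0 (R : realType) n (P : 'M[R]_n) i j : hit_le P i j 0 = 0.
Proof. by rewrite /hit_le big_geq. Qed.

Lemma hit_leS_rec (R : realType) n (P : 'M[R]_n) i j t :
  hit_le P i j t.+1 = P i j + \sum_(k | k != j) P i k * hit_le P k j t.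
Proof.
rewrite /hit_le big_nat_recl // first_pass1; congr (_ + _).
under [RHS]eq_bigr do rewrite mulr_sumr.
rewrite exchange_big /= [LHS]big_nat [RHS]big_nat.
by apply: eq_bigr => -[|m] // _; rewrite first_passS.
Qed.

Lemma hit_le_neq (R : realType) n (P : 'M[R]_n) i j t : i != j ->
  hit_le P i j t = hit_prob P j t i.
Proof.
elim: t i => [|t IH] i ij; first by rewrite hit_le0 /= (negPf ij).
rewrite hit_leS_rec hit_prob_neq // [RHS](bigD1 j) //= hit_prob_id mulr1.
by congr (_ + _); apply: eq_bigr => k kj; rewrite IH.
Qed.

Lemma hit_leS (R : realType) n (P : 'M[R]_n) i j t :
  hit_le P i j t.+1 = \sum_k P i k * hit_prob P j t k.
Proof.
rewrite hit_leS_rec [RHS](bigD1 j) //= hit_prob_id mulr1; congr (_ + _).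
by apply: eq_bigr => k kj; rewrite hit_le_neq.
Qed.

(** * Reduction to the two end-to-end pairs *)

Lemma hit_prob_ge0 {R : realType} {n} {P : 'M[R]_n} j t i :
  conforming P -> 0 <= hit_prob P j t i.
Proof.
move=> [P0 _]; elim: t i => [|t IH] i /=; case: ifP => // _.
by apply: sumr_ge0 => k _; apply: mulr_ge0.
Qed.

(** A row is a probability vector carried by the neighbours of [i]. *)
Lemma row_average_le {R : realType} {n} {P : 'M[R]_n} i (f : 'I_n -> R) c :
  conforming P -> (forall k, line_edge i k -> f k <= c) ->
  \sum_k P i k * f k <= c.
Proof.
move=> [P0 [P1 PE]] fc; rewrite -[leRHS]mul1r -(P1 i) mulr_suml.
apply: ler_sum => k _; case: (boolP (line_edge i k)) => [/fc|/PE ->].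
  by move=> ?; apply: ler_wpM2l.
by rewrite !mul0r.
Qed.

Lemma row_average_ge {R : realType} {n} {P : 'M[R]_n} i (f : 'I_n -> R) c :
  conforming P -> (forall k, line_edge i k -> c <= f k) ->
  c <= \sum_k P i k * f k.
Proof.
move=> [P0 [P1 PE]] fc; rewrite -[leLHS]mul1r -(P1 i) mulr_suml.
apply: ler_sum => k _; case: (boolP (line_edge i k)) => [/fc|/PE ->].
  by move=> ?; apply: ler_wpM2l.
by rewrite !mul0r.
Qed.

Lemma row_average_mono {R : realType} {n} {P : 'M[R]_n} i (f g : 'I_n -> R) :
  conforming P -> (forall k, line_edge i k -> f k <= g k) ->
  \sum_k P i k * f k <= \sum_k P i k * g k.
Proof.
move=> [P0 [_ PE]] fg; apply: ler_sum => k _.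
case: (boolP (line_edge i k)) => [/fg ?|/PE ->]; first exact: ler_wpM2l.
by rewrite !mul0r.
Qed.

Lemma hit_prob_le1 {R : realType} {n} {P : 'M[R]_n} j t i :
  conforming P -> hit_prob P j t i <= 1.
Proof.
move=> cP; elim: t i => [|t IH] i /=; case: ifP => // _.
by apply: row_average_le.
Qed.

Lemma hit_prob_leS {R : realType} {n} {P : 'M[R]_n} j t i :
  conforming P -> hit_prob P j t i <= hit_prob P j t.+1 i.
Proof.
move=> cP; elim: t i => [|t IH] i.
  rewrite [leLHS]/=; case: ifP => [/eqP->|_]; first by rewrite hit_prob_id.
  exact: hit_prob_ge0.
rewrite [leLHS]/= [leRHS]/=; case: ifP => // _.
by apply: row_average_mono.
Qed.

(* A walk on the line from [i] to [j] first spends at least one step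
   reaching [k]. *)
Lemma hit_prob_start {R : realType} {n} {P : 'M[R]_n} (i k j : 'I_n) t :
  conforming P -> (i < k <= j)%N -> hit_prob P j t.+1 i <= hit_prob P j t k.
Proof.
move=> cP; elim: t i k => [|t IH] i k /andP[ik kj].
  rewrite hit_prob_neq; last by rewrite -val_eqE /=; lia.
  apply: row_average_le => // m; rewrite /line_edge => Em /=.
  case: (m =P j) => [mj|_]; last by case: ifP.
  by rewrite -mj in kj *; rewrite ifT // -val_eqE /= ; move: Em; rewrite -!val_eqE /=; lia.
rewrite hit_prob_neq; last by rewrite -val_eqE /=; lia.
apply: row_average_le => // m; rewrite /line_edge => Em.
(* One step cannot jump over [k]: the walk is at [k], or still below it and the induction hypothesis
   applies with a step to spare. *)
have : (m <= k)%N by move: Em; rewrite -!val_eqE /=; lia.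
rewrite leq_eqVlt => /orP[/eqP/val_inj -> //|mk].
by apply: le_trans (hit_prob_leS _ _ _ cP); apply: IH; rewrite mk kj.
Qed.

(** Steps have length at most one, so a walk from [i] to [l] visits [j] first and then needs at
    least one more step. *)
Lemma hit_prob_target {R : realType} {n} {P : 'M[R]_n} (i j l : 'I_n) t :
  conforming P -> (i <= j < l)%N -> hit_prob P l t.+1 i <= hit_prob P j t i.
Proof.
move=> cP; elim: t i => [|t IH] i /andP[ij jl].
  rewrite hit_prob_neq; last by rewrite -val_eqE /=; lia.
  apply: row_average_le => // m; rewrite /line_edge => Em /=.
  case: (m =P l) => [ml|_]; last by case: ifP.
  by rewrite -ml in jl; rewrite ifT // -val_eqE /=; move: Em; rewrite -!val_eqE /=; lia.
case: (i =P j) => [->|/eqP ij']; first by rewrite hit_prob_id hit_prob_le1.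
rewrite [leRHS]hit_prob_neq // hit_prob_neq; last by rewrite -val_eqE /=; lia.
apply: row_average_mono => // m; rewrite /line_edge => Em; apply: IH.
by move: Em ij'; rewrite -!val_eqE /=; lia.
Qed.

(** Reversing the line turns each estimate for upward crossings into one for downward crossings. *)
Definition reflect_mx {R : realType} {n} (P : 'M[R]_n) : 'M[R]_n :=
  \matrix_(i, j) P (rev_ord i) (rev_ord j).

Lemma reflect_conforming {R : realType} {n} {P : 'M[R]_n} :
  conforming P -> conforming (reflect_mx P).
Proof.
move=> [P0 [P1 PE]]; split; [|split] => [i j|i|i j]; rewrite ?mxE //.
  by under eq_bigr do rewrite mxE; rewrite -(P1 (rev_ord i)) [RHS](reindex_inj rev_ord_inj).
move=> e; apply: PE; apply: contra e; rewrite /line_edge -!val_eqE /=.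
have := ltn_ord i; have := ltn_ord j; lia.
Qed.

Lemma hit_prob_reflect {R : realType} {n} (P : 'M[R]_n) j t i :
  hit_prob (reflect_mx P) j t i = hit_prob P (rev_ord j) t (rev_ord i).
Proof.
elim: t i => [|t IH] i /=; rewrite (inj_eq rev_ord_inj) //; case: ifP => // _.
rewrite [RHS](reindex_inj rev_ord_inj).
by apply: eq_bigr => k _; rewrite IH mxE.
Qed.

Lemma hit_prob_target_weak {R : realType} {n} {P : 'M[R]_n} (i j l : 'I_n) t :
  conforming P -> (i <= j <= l)%N -> hit_prob P l t i <= hit_prob P j t i.
Proof.
move=> cP /andP[ij]; rewrite leq_eqVlt => /orP[/eqP/val_inj -> //|jl].
case: t => [|t]; last first.
  by apply: le_trans (hit_prob_leS _ _ _ cP); apply: hit_prob_target; rewrite // ij.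
rewrite [leLHS]/= ifF ?hit_prob_ge0 //.
by rewrite -val_eqE /=; lia.
Qed.

(** The pair misses an end, so an end-to-end crossing spends a step before [i] or after [j]. This
    saved step later pays for the first step of a return. *)
Lemma hit_prob_ge_end {R : realType} {n} {P : 'M[R]_n.+1} (i j : 'I_n.+1) t :
  conforming P -> (i < j)%N -> (0 < i)%N || (j < n)%N ->
  hit_prob P ord_max t.+1 ord0 <= hit_prob P j t i.
Proof.
move=> cP ij; have := ltn_ord j => jn; case: (posnP i) => [i0 /= jM|i0 _].
  have -> : i = ord0 by apply: val_inj.
  exact: hit_prob_target.
apply: le_trans (hit_prob_start _ i _ _ cP _) _; first by rewrite i0 /=; lia.
by apply: hit_prob_target_weak => //=; lia.
Qed.

(* The two pairs of opposite end nodes are the hardest ones. *)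
Lemma hit_le_ge_ends {R : realType} {n} {P : 'M[R]_n.+3} (i j : 'I_n.+3) t c :
  conforming P -> c <= hit_prob P ord_max t.+1 ord0 ->
  c <= hit_prob P ord0 t.+1 ord_max -> c <= hit_le P i j t.+1.
Proof.
move=> cP cr cl.
have c1 : c <= 1 by apply: le_trans cr (hit_prob_le1 _ _ _ cP).
have up (k l : 'I_n.+3) : (k < l)%N -> (0 < k)%N || (l < n.+2)%N ->
    c <= hit_prob P l t k.
  by move=> kl e; apply: le_trans cr (hit_prob_ge_end _ _ _ cP kl e).
have down (k l : 'I_n.+3) : (l < k)%N -> (0 < l)%N || (k < n.+2)%N ->
    c <= hit_prob P l t k.
  move=> kl e; rewrite -[l]rev_ordK -[k]rev_ordK -hit_prob_reflect.
  apply: le_trans (hit_prob_ge_end _ _ _ (reflect_conforming cP) _ _).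
  - rewrite hit_prob_reflect.
    have -> : rev_ord ord_max = ord0 :> 'I_n.+3 by apply: val_inj; rewrite /= subnn.
    by have -> : rev_ord ord0 = ord_max :> 'I_n.+3 by apply: val_inj; rewrite /= subn1.
  - by have := ltn_ord k; rewrite /=; lia.
  - by have := ltn_ord k; rewrite /=; lia.
have hi := ltn_ord i; have hj := ltn_ord j.
case: (ltngtP i j) => [ij|ji|/val_inj <-].
- rewrite hit_le_neq; last by rewrite -val_eqE /=; lia.
  case: (boolP ((0 < i)%N || (j < n.+2)%N)) => [e|].
    exact: le_trans (up _ _ ij e) (hit_prob_leS _ _ _ cP).
  rewrite negb_or -leqNgt leqn0 -leqNgt => /andP[/eqP i0 jM].
  have -> : i = ord0 by apply: val_inj.
  by have -> : j = ord_max by apply: val_inj => /=; lia.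
- rewrite hit_le_neq; last by rewrite -val_eqE /=; lia.
  case: (boolP ((0 < j)%N || (i < n.+2)%N)) => [e|].
    exact: le_trans (down _ _ ji e) (hit_prob_leS _ _ _ cP).
  rewrite negb_or -leqNgt leqn0 -leqNgt => /andP[/eqP j0 iM].
  have -> : j = ord0 by apply: val_inj.
  by have -> : i = ord_max by apply: val_inj => /=; lia.
(* A return moves to a neighbour and then comes back within time [t]. With at least three nodes,
   adjacent nodes are never the two opposite ends, so [up] and [down] apply. *)
rewrite hit_leS; apply: row_average_ge => // k; rewrite /line_edge => Ek.
case: (ltngtP i k) => [ik|ki|/val_inj <-]; last by rewrite hit_prob_id.
- by apply: down => //; move: Ek; rewrite -!val_eqE /=; lia.
- by apply: up => //; move: Ek; rewrite -!val_eqE /=; lia.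
Qed.

(** The objective is at most either end-to-end probability, and conversely these two bound every
    pair from below, so optimality passes to [Q] by comparing the ends alone. *)
Lemma optimal_of_ends {R : realType} {n tau} {P Q : 'M[R]_n.+3} :
  (0 < tau)%N -> optimal tau P -> conforming Q ->
  Num.min (hit_prob P ord_max tau ord0) (hit_prob P ord0 tau ord_max) <=
  Num.min (hit_prob Q ord_max tau ord0) (hit_prob Q ord0 tau ord_max) ->
  optimal tau Q.
Proof.
case: tau => // t _ [cP oP] cQ PQ; split=> // Q' cQ'; apply: le_trans (oP _ cQ') _.
have objP i j : objective P t.+1 <= hit_le P i j t.+1.
  exact: le_trans (bigmin_le _ i _) (bigmin_le _ j _).
have : objective P t.+1 <= Num.min (hit_prob Q ord_max t.+1 ord0) (hit_prob Q ord0 t.+1 ord_max).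
  by apply: le_trans PQ; rewrite le_min -!hit_le_neq // !objP.
rewrite le_min => /andP[Q1 Q2].
(* Handles the starting value 1 of the min-folds. *)
have o1 : objective P t.+1 <= 1 by apply: le_trans Q1 (hit_prob_le1 _ _ _ cQ).
apply: le_bigmin => // i _; apply: le_bigmin => // j _.
exact: hit_le_ge_ends.
Qed.

(** * Duality between a walk and the walk with exchanged steps *)

(* [p i] is the probability of a step up from an inner node [i] in [reach_top],
   and of a step down in [reach_bot]; the end nodes reflect. *)
Fixpoint reach_top {R : realType} (p : nat -> R) (N t i : nat) : R :=
  if (N <= i)%N then 1 else
  if t is t'.+1 then
    if i is i'.+1 then
      p i * reach_top p N t' i.+1 + (1 - p i) * reach_top p N t' i'
    else reach_top p N t' 1
  else 0.

Fixpoint reach_bot {R : realType} (p : nat -> R) (N t i : nat) : R :=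
  if i is i'.+1 then
    if t is t'.+1 then
      if i == N then reach_bot p N t' i'
      else (1 - p i) * reach_bot p N t' i.+1 + p i * reach_bot p N t' i'
    else 0
  else 1.

Lemma reach_top_geq {R : realType} (p : nat -> R) N t i : (N <= i)%N ->
  reach_top p N t i = 1.
Proof. by case: t => [|t] /= ->. Qed.

Lemma reach_top0S {R : realType} (p : nat -> R) N t : (0 < N)%N ->
  reach_top p N t.+1 0 = reach_top p N t 1.
Proof. by case: N. Qed.

Lemma reach_topS {R : realType} (p : nat -> R) N t i : (i.+1 < N)%N ->
  reach_top p N t.+1 i.+1 =
  p i.+1 * reach_top p N t i.+2 + (1 - p i.+1) * reach_top p N t i.
Proof. by move=> iN /=; rewrite leqNgt iN. Qed.

Lemma reach_bot0 {R : realType} (p : nat -> R) N t : reach_bot p N t 0 = 1.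
Proof. by case: t. Qed.

(* Pairs the increments of [reach_top], seen as occupation measures of the
   exchanged walk, with the hitting probabilities of that same walk; only the
   mass absorbed at [0] is lost when a step passes from one to the other. *)
Definition duality_pairing {R : realType} (p : nat -> R) N k t : R :=
  \sum_(0 <= i < N)
    (reach_top p N k i.+2 - reach_top p N k i) * reach_bot p N t i.+1.

(** Summation by parts moves one time step from [reach_bot] to [reach_top]. *)
Lemma duality_pairing_shift {R : realType} (p : nat -> R) N k t : (0 < N)%N ->
  duality_pairing p N k t.+1 =
  duality_pairing p N k.+1 t + (reach_top p N k.+2 0 - reach_top p N k 0).
Proof.
move=> N0; rewrite (reach_top0S p N k.+1) //; pose V := reach_top p N; pose W := reach_bot p N.
(* By the recursion of [reach_top], the two new differences are [1 - p] and [p] times the increment,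
   which are the step weights of [reach_bot]. At [i.+1 = N] the first one vanishes, matching the
   reflection there. *)
have flux i : (i < N)%N ->
    (V k i.+2 - V k i) * W t.+1 i.+1 =
    (V k i.+2 - V k.+1 i.+1) * W t i.+2 + (V k.+1 i.+1 - V k i) * W t i.
  rewrite leq_eqVlt => /orP[/eqP iN|iN].
    rewrite /V /W -iN (reach_top_geq p i.+1 k i.+2) // (reach_top_geq p i.+1 k.+1 i.+1) //.
    by rewrite /= eqxx; ring.
  by rewrite /V reach_topS // /W /= ifF; [ring|lia].
have -> : duality_pairing p N k t.+1 = \sum_(0 <= i < N)
    ((V k i.+2 - V k.+1 i.+1) * W t i.+2 + (V k.+1 i.+1 - V k i) * W t i).
  by rewrite /duality_pairing big_nat [RHS]big_nat; apply: eq_bigr => i /andP[_ /flux].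
(* Shifting the indices of [f] and [g] realigns both with [W t i.+1]. All boundary terms vanish
   except [g 0], the mass absorbed at 0. *)
pose f i := (V k i.+1 - V k.+1 i) * W t i.+1.
pose g i := (V k.+1 i.+1 - V k i) * W t i.
have fE : \sum_(0 <= i < N) f i.+1 = \sum_(0 <= i < N) f i.
  have f0 : f 0%N = 0 by rewrite /f /V reach_top0S // subrr mul0r.
  have fN : f N = 0 by rewrite /f /V !reach_top_geq // subrr mul0r.
  have := @big_nat_recl R 0 +%R N 0 f (leq0n _); rewrite f0 add0r => <-.
  by rewrite big_nat_recr //= fN addr0.
have gE : \sum_(0 <= i < N) g i = \sum_(0 <= i < N) g i.+1 + g 0%N.
  have gN : g N = 0 by rewrite /g /V !reach_top_geq // subrr mul0r.
  by rewrite addrC -big_nat_recl // big_nat_recr //= gN addr0.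
rewrite big_split /= -/(\sum_(0 <= i < N) f i.+1).
rewrite [X in X + _]fE [X in _ + X]gE addrA -big_split /=; congr (_ + _).
  by apply: eq_bigr => i _; rewrite /f /g /V /W; ring.
by rewrite /g /V /W reach_bot0 mulr1.
Qed.

(** Iterating the shift ends at [t = 0], where [reach_bot] vanishes off 0. The losses are increments
    over two time units, so the telescoping leaves two consecutive values at each end. *)
Lemma duality_pairing_sum {R : realType} (p : nat -> R) N t k : (0 < N)%N ->
  duality_pairing p N k t =
  reach_top p N (t + k).+1 0 + reach_top p N (t + k) 0
  - reach_top p N k.+1 0 - reach_top p N k 0.
Proof.
move=> N0; elim: t k => [|t IH] k.
  by rewrite add0n /duality_pairing big1 => [|i _] /=; rewrite ?mulr0 //; ring.
by rewrite duality_pairing_shift // IH addSnnS; ring.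
Qed.

(** At [k = 0] the increments are 1 exactly at the last two indices, so the pairing equals
    [reach_bot] at [N] summed over times [t] and [t.+1]. It also equals the same sum for [reach_top]
    at 0, and induction cancels the terms at time [t]. *)
Lemma reach_duality {R : realType} (p : nat -> R) N t : (1 < N)%N ->
  reach_top p N t 0 = reach_bot p N t N.
Proof.
move=> N1; elim: t => [|t IH]; first by case: N N1.
have WE : duality_pairing p N 0 t = reach_bot p N t N.-1 + reach_bot p N t N.
  have top0 m : reach_top p N 0 m = (N <= m)%:R by rewrite /=; case: ifP.
  case: N N1 {IH} top0 => [|[|N]] // _ top0; rewrite /duality_pairing.
  rewrite big_nat_recr // big_nat_recr // !top0 big_nat big1 => [|i /andP[_ iN]].
    by rewrite !leqnSn !leqnn !ltnn !ltnNge !leqnSn /= add0r !subr0 !mul1r.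
  rewrite !top0; have -> : (N.+2 <= i.+2)%N = false by lia.
  by have -> : (N.+2 <= i)%N = false by [lia]; rewrite subrr mul0r.
have := duality_pairing_sum p N t 0 (ltnW N1).
rewrite addn0 WE -IH (reach_top0S p N 0) ?(ltnW N1) //.
have -> : reach_bot p N t.+1 N = reach_bot p N t N.-1.
  by case: N N1 {IH WE} => [|N] //= _; rewrite eqxx.
have -> : reach_top p N 0 1 = 0 by rewrite /= leqNgt N1.
have -> : reach_top p N 0 0 = 0 by rewrite /= leqNgt ltnW.
by move=> H; apply: (addIr (reach_top p N t 0)); rewrite H; ring.
Qed.

(** * Loop removal and step exchange for strategies *)

Lemma sum_neighbours {R : realType} {n} (f : 'I_n.+3 -> R) (i : 'I_n.+3) :
  (forall k : 'I_n.+3, (i.+1 == k :> nat) || (k.+1 == i :> nat) = false -> f k = 0) ->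
  \sum_k f k = (if (i < n.+2)%N then f (inord i.+1) else 0) +
               (if (0 < i)%N then f (inord i.-1) else 0).
Proof.
move=> f0; have hi := ltn_ord i.
case: ifP => [iM|iM].
  rewrite (bigD1 (inord i.+1)) //=; congr (_ + _); case: ifP => i0.
    rewrite (bigD1 (inord i.-1)) /=; last by rewrite -val_eqE /= !inordK; lia.
    rewrite big1 ?addr0 // => k; rewrite -!val_eqE /= !inordK; try lia.
    by move=> e; apply: f0; lia.
  rewrite big1 // => k; rewrite -!val_eqE /= !inordK; last by lia.
  by move=> e; apply: f0; lia.
rewrite add0r ifT; last by lia.
rewrite (bigD1 (inord i.-1)) //= big1 ?addr0 // => k.
rewrite -!val_eqE /= !inordK; last by lia.
by have := ltn_ord k; move=> ? e; apply: f0; lia.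
Qed.

Definition loopless {R : realType} {n} (P : 'M[R]_n) := forall i, P i i = 0.

Lemma loopless_row {R : realType} {n} {P : 'M[R]_n.+3} (f : 'I_n.+3 -> R) i :
  conforming P -> loopless P ->
  \sum_k P i k * f k =
  (if (i < n.+2)%N then P i (inord i.+1) * f (inord i.+1) else 0) +
  (if (0 < i)%N then P i (inord i.-1) * f (inord i.-1) else 0).
Proof.
move=> [_ [_ PE]] P0; rewrite (sum_neighbours (fun k => P i k * f k) i) // => k e.
case: (i =P k) => [<-|/eqP ik]; first by rewrite P0 mul0r.
by rewrite PE ?mul0r // /line_edge (negPf ik) /= e.
Qed.

Lemma loopless_row1 {R : realType} {n} {P : 'M[R]_n.+3} (i : 'I_n.+3) :
  conforming P -> loopless P ->
  (if (i < n.+2)%N then P i (inord i.+1) else 0) +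
  (if (0 < i)%N then P i (inord i.-1) else 0) = 1.
Proof.
move=> cP P0; case: (cP) => _ [P1 _]; rewrite -(P1 i).
under [RHS]eq_bigr do rewrite -[P i _]mulr1.
by rewrite loopless_row // !mulr1.
Qed.

(** Without loops an inner row is fixed by its upward probability, and an end node must step to its
    only neighbour. *)
Lemma hit_prob_reach_top {R : realType} {n} {P : 'M[R]_n.+3} (p : nat -> R) t (i : 'I_n.+3) :
  conforming P -> loopless P ->
  (forall k : 'I_n.+3, (0 < k < n.+2)%N -> P k (inord k.+1) = p k) ->
  hit_prob P ord_max t i = reach_top p n.+2 t i.
Proof.
move=> cP P0 Pp; elim: t i => [|t IH] i; have hi := ltn_ord i.
  by rewrite /= -val_eqE /=; have -> : (i == n.+2 :> nat) = (n.+1 < i)%N by lia.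
case: (ltnP i n.+2) => iM; last first.
  rewrite reach_top_geq //; have -> : i = ord_max by apply: val_inj => /=; lia.
  by rewrite hit_prob_id.
rewrite hit_prob_neq; last by rewrite -val_eqE /=; lia.
rewrite loopless_row //; have := loopless_row1 i cP P0; rewrite !iM !IH.
case: (posnP i) => [i0|i0].
  by rewrite !addr0 => ->; rewrite mul1r i0 reach_top0S // inordK.
have -> : P i (inord i.+1) = p i by apply: Pp; rewrite i0.
move=> /(canRL (addKr _)) ->; rewrite !inordK; try lia.
by case: (nat_of_ord i) i0 iM => // k _ kM; rewrite reach_topS // addrC [in RHS]addrC [- _ + _]addrC.
Qed.

Lemma hit_prob_reach_bot {R : realType} {n} {P : 'M[R]_n.+3} (p : nat -> R) t (i : 'I_n.+3) :
  conforming P -> loopless P ->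
  (forall k : 'I_n.+3, (0 < k < n.+2)%N -> P k (inord k.-1) = p k) ->
  hit_prob P ord0 t i = reach_bot p n.+2 t i.
Proof.
move=> cP P0 Pp; elim: t i => [|t IH] i; have hi := ltn_ord i.
  by rewrite /= -val_eqE /=; case: (nat_of_ord i).
case: (posnP i) => [i0|i0].
  by have -> : i = ord0 by [apply: val_inj]; rewrite hit_prob_id.
rewrite hit_prob_neq; last by rewrite -val_eqE /=; lia.
rewrite loopless_row //; have := loopless_row1 i cP P0; rewrite !i0 !IH.
case: ifP => iM; last first.
  rewrite !add0r => ->; rewrite mul1r inordK; last by lia.
  have -> : nat_of_ord i = n.+2 by lia.
  by rewrite /= eqxx.
have -> : P i (inord i.-1) = p i by apply: Pp; rewrite i0.
move=> /(canRL (addrK _)) ->; rewrite !inordK; try lia.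
by case: (nat_of_ord i) i0 iM => // k _ kM; rewrite /= ifF //; lia.
Qed.

Definition swap_steps {R : realType} {n} (P : 'M[R]_n.+3) : 'M[R]_n.+3 :=
  \matrix_(i, j)
    if (0 < i < n.+2)%N then
      if i.+1 == j :> nat then P i (inord i.-1)
      else if j.+1 == i :> nat then P i (inord i.+1) else 0
    else P i j.

Lemma swap_steps_up {R : realType} {n} (P : 'M[R]_n.+3) (k : 'I_n.+3) :
  (0 < k < n.+2)%N -> swap_steps P k (inord k.+1) = P k (inord k.-1).
Proof. by move=> hk; rewrite mxE hk ifT // inordK; lia. Qed.

Lemma swap_steps_down {R : realType} {n} (P : 'M[R]_n.+3) (k : 'I_n.+3) :
  (0 < k < n.+2)%N -> swap_steps P k (inord k.-1) = P k (inord k.+1).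
Proof.
by move=> hk; rewrite mxE hk ifF ?ifT // inordK; have := ltn_ord k; lia.
Qed.

Lemma swap_steps_loopless {R : realType} {n} {P : 'M[R]_n.+3} :
  loopless P -> loopless (swap_steps P).
Proof.
move=> P0 i; rewrite mxE; case: ifP => // _.
by rewrite !ifF //; lia.
Qed.

Lemma swap_steps_conforming {R : realType} {n} {P : 'M[R]_n.+3} :
  conforming P -> loopless P -> conforming (swap_steps P).
Proof.
move=> cP P0; have [Pge [P1 PE]] := cP; split; [|split] => [i j|i|i j].
- by rewrite mxE; do 3?case: ifP.
- case: (boolP (0 < i < n.+2)%N) => hi; last first.
    by under eq_bigr do rewrite mxE (negPf hi).
  rewrite (sum_neighbours _ i) => [|k /norP]; last first.
    by rewrite mxE hi => -[/negPf -> /negPf ->].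
  rewrite swap_steps_up // swap_steps_down //.
  have := loopless_row1 i cP P0; case/andP: hi => -> ->.
  by rewrite addrC.
rewrite /line_edge mxE => e; case: ifP => _; last exact: PE.
by rewrite !ifF //; lia.
Qed.

(** The upward probabilities of [P] are the downward ones of [swap_steps P], so a single [p] drives
    both sides of [reach_duality]. *)
Lemma swap_steps_duality {R : realType} {n} {P : 'M[R]_n.+3} t :
  conforming P -> loopless P ->
  hit_prob P ord_max t ord0 = hit_prob (swap_steps P) ord0 t ord_max.
Proof.
move=> cP P0; pose p i := P (inord i) (inord i.+1).
rewrite (hit_prob_reach_top p) //; last by move=> k _; rewrite /p inord_val.
rewrite (hit_prob_reach_bot p); first exact: reach_duality.
- exact: swap_steps_conforming.
- exact: swap_steps_loopless.
by move=> k hk; rewrite swap_steps_down // /p inord_val.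
Qed.

Lemma swap_stepsK {R : realType} {n} {P : 'M[R]_n.+3} :
  conforming P -> loopless P -> swap_steps (swap_steps P) = P.
Proof.
move=> [_ [_ PE]] P0; apply/matrixP=> i j; rewrite mxE.
case: ifP => hi; last by rewrite mxE hi.
case: eqP => [ij|/eqP ij].
  by rewrite swap_steps_down // ij inord_val.
case: eqP => [ji|/eqP ji]; first by rewrite swap_steps_up // -ji inord_val.
case: (i =P j) => [<-|/eqP ij']; first by rewrite P0.
by rewrite PE // /line_edge !negb_or ij' ij ji.
Qed.

(** * The strategy [Pstar] and the removal of self-loops *)

Lemma PstarE (R : realType) n (i j : 'I_n.+3) :
  Pstar R n.+3 i j =
  if i == 0%N :> nat then (j == 1%N :> nat)%:R
  else if i == n.+2 :> nat then (j == n.+1 :> nat)%:R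
  else if (i.+1 == j :> nat) || (j.+1 == i :> nat) then 2^-1 else 0.
Proof. by rewrite mxE orbC; do 2?[case: ifP => _; first by case: eqP]. Qed.

Lemma Pstar_loopless (R : realType) n : loopless (Pstar R n.+3).
Proof.
move=> i; rewrite PstarE; case: eqP => [->|_] //.
case: eqP => [->|_]; first by rewrite gtn_eqF.
by rewrite ifF //; lia.
Qed.

Lemma Pstar_conforming (R : realType) n : conforming (Pstar R n.+3).
Proof.
have off (i j : 'I_n.+3) : (i.+1 == j :> nat) || (j.+1 == i :> nat) = false ->
    Pstar R n.+3 i j = 0.
  move=> e; have := ltn_ord j; rewrite PstarE e.
  case: eqP => [i0|_]; first by case: eqP => //; lia.
  by case: eqP => // iM; case: eqP => //; lia.
split; [|split] => [i j|i|i j].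
- by rewrite PstarE; do 3?case: ifP => // _; rewrite ?ler0n ?invr_ge0 ?ler0n.
- have hi := ltn_ord i.
  rewrite (sum_neighbours _ i); last exact: off.
  rewrite !PstarE; case: (posnP i) => [i0|i0].
    by rewrite i0 /= inordK // addr0.
  case: ifP => iM.
    have -> : (i == n.+2 :> nat) = false by lia.
    by rewrite !inordK ?prednK ?eqxx ?orbT /=; try lia; lra.
  have -> : nat_of_ord i = n.+2 by lia.
  by rewrite !eqxx /= inordK // eqxx add0r.
by rewrite /line_edge -orbA negb_or => /andP[_ /negbTE /off].
Qed.

(** Each row is conditioned on leaving its node. An absorbing node has no such conditional law and
    borrows its row from [Pstar], which is loopless. *)
Definition remove_loops {R : realType} {n} (P : 'M[R]_n.+3) : 'M[R]_n.+3 :=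
  \matrix_(i, j)
    if P i i == 1 then Pstar R n.+3 i j
    else if i == j then 0 else P i j / (1 - P i i).

Lemma remove_loops_loopless {R : realType} {n} (P : 'M[R]_n.+3) :
  loopless (remove_loops P).
Proof. by move=> i; rewrite mxE Pstar_loopless eqxx; case: ifP. Qed.

Lemma loop_le1 {R : realType} {n} {P : 'M[R]_n} i : conforming P -> P i i <= 1.
Proof.
by move=> [P0 [P1 _]]; rewrite -(P1 i) (bigD1 i) //= lerDl; apply: sumr_ge0.
Qed.

Lemma remove_loops_conforming {R : realType} {n} {P : 'M[R]_n.+3} :
  conforming P -> conforming (remove_loops P).
Proof.
move=> cP; have [S0 [S1 SE]] := Pstar_conforming R n; have [P0 [P1 PE]] := cP.
split; [|split] => [i j|i|i j].
- rewrite mxE; case: ifP => // _; case: ifP => // _.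
  by rewrite divr_ge0 // subr_ge0 loop_le1.
- case: (boolP (P i i == 1)) => Pi.
    by under eq_bigr do rewrite mxE Pi.
  rewrite (bigD1 i) //= remove_loops_loopless add0r.
  rewrite (eq_bigr (fun j => P i j / (1 - P i i))) => [|j ji]; last first.
    by rewrite mxE (negPf Pi) eq_sym (negPf ji).
  have := P1 i; rewrite -mulr_suml (bigD1 i) //= => /(canRL (addKr _)) ->.
  by rewrite addrC divff // subr_eq0 eq_sym.
move=> e; rewrite mxE SE // (PE i j) // mul0r.
by case: ifP => // _; case: ifP.
Qed.

(* Without its holding times the walk visits the same nodes, only sooner. *)
Lemma hit_prob_remove_loops {R : realType} {n} {P : 'M[R]_n.+3} j t i :
  conforming P -> hit_prob P j t i <= hit_prob (remove_loops P) j t i.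
Proof.
move=> cP; have cQ := remove_loops_conforming cP.
elim: t i => [|t IH] i //; case: (i =P j) => [->|/eqP ij].
  by rewrite !hit_prob_id.
have le1 := loop_le1 i cP; have [P0 [P1 _]] := cP.
case: (boolP (P i i == 1)) => Pi.
  (* From an absorbing node other than [j] the target is never reached. *)
  suff -> : hit_prob P j t.+1 i = 0 by exact: hit_prob_ge0.
  have Pik k : k != i -> P i k = 0.
    have := P1 i; rewrite (bigD1 i) //= (eqP Pi) => /(canRL (addKr _)) /eqP.
    by rewrite addNr psumr_eq0 // => /allP /(_ k (mem_index_enum k)) /implyP h /h /eqP.
  elim: t.+1 => [|s IHs]; first by rewrite /= (negPf ij).
  rewrite hit_prob_neq // (bigD1 i) //= IHs mulr0 add0r big1 // => k /Pik ->.
  by rewrite mul0r.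
have Pi0 : 0 < 1 - P i i by rewrite subr_gt0 lt_neqAle Pi.
(* Clearing the denominator [1 - P i i] leaves a loop term, bounded by monotonicity in time, and the
   other terms, bounded by induction. *)
rewrite -(ler_pM2l Pi0) mulrBl mul1r lerBlDr.
rewrite [leLHS]hit_prob_neq // (bigD1 i) //= addrC; apply: lerD; last first.
  by apply: ler_wpM2l => //; exact: hit_prob_leS.
rewrite (negPf ij) mulr_sumr [leRHS](bigD1 i) //= remove_loops_loopless.
rewrite mul0r mulr0 add0r; apply: ler_sum => k ki.
rewrite mxE (negPf Pi) eq_sym (negPf ki) mulrA mulrCA divff ?gt_eqF // mulr1.
exact: ler_wpM2l.
Qed.

Theorem theorem3 (R : realType) (n tau : nat) :
  (3 <= n)%N -> (n.-1 <= tau)%N -> (tau <= 2 * n - 3)%N ->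
  (exists P : 'M[R]_n, optimal tau P) ->
  (forall P Q : 'M[R]_n, optimal tau P -> optimal tau Q -> P = Q) ->
  forall P : 'M[R]_n, optimal tau P -> P = Pstar R n.
Proof.
case: n => [|[|[|n]]] // _ tau_ge _ _ uniqP P oP.
have tau0 : (0 < tau)%N by apply: leq_trans tau_ge.
have [cP _] := oP.
have P0 : loopless P.
  suff -> : P = remove_loops P by exact: remove_loops_loopless.
  apply: uniqP => //; apply: (optimal_of_ends tau0 oP).
    exact: remove_loops_conforming.
  by rewrite le_min !ge_min !hit_prob_remove_loops // orbT.
have cS := swap_steps_conforming cP P0.
have PS : P = swap_steps P.
  apply: uniqP => //; apply: (optimal_of_ends tau0 oP) => //.
  (* Duality for [P] and for its exchange shows that the two end-to-end probabilities trade places,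
     so their minimum is unchanged. *)
  rewrite minC (swap_steps_duality tau cP P0).
  by rewrite (swap_steps_duality tau cS (swap_steps_loopless P0)) swap_stepsK.
apply/matrixP => i j; have [_ [_ PE]] := cP.
have := loopless_row1 i cP P0; have hi := ltn_ord i; have hj := ltn_ord j.
have PE' : (i.+1 == j :> nat) || (j.+1 == i :> nat) = false -> P i j = 0.
  move=> e; case: (i =P j) => [<-|/eqP ij]; first exact: P0.
  by rewrite PE // /line_edge (negPf ij) e.
(* At an end node the row sum puts all mass on the single neighbour. *)
rewrite PstarE; case: (posnP i) => [i0|i0].
  rewrite i0 /= addr0; case: eqP => [j1 <-|/eqP j1 _].
    by congr (P _ _); apply: val_inj; rewrite /= inordK.
  by apply: PE'; lia.
case: ifP => iM; last first.
  rewrite ifT ?add0r; last by lia.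
  case: eqP => [jE <-|/eqP jE _]; last by apply: PE'; lia.
  by congr (P _ _); apply: val_inj; rewrite /= inordK; lia.
rewrite (_ : (i : nat) == n.+2 = false); last by lia.
(* Invariance under the exchange makes both inner steps equal; the row sum then gives one half. *)
have up : P i (inord i.+1) = P i (inord i.-1).
  by rewrite {1}PS swap_steps_up // i0 iM.
rewrite up => half; have {}half : P i (inord i.-1) = 2^-1 by lra.
case: ifP => [/orP[/eqP ij|/eqP ji]|e]; last by apply: PE'.
  by rewrite -half -up ij inord_val.
by rewrite -half -ji inord_val.
Qed.
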